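(* Let $n\ge1$ and let $[\mathbf i_0]$ be a twisted adapted class of type $A_{2n+1}$. Let $\gamma\in\Phi^+\setminus\Pi$ be a non-induced (central) vertex of $\Upsilon_{[\mathbf i_0]}$, so that $\Omega_{[\mathbf i_0]}(\gamma)=(n+1,r)$. Let $(\alpha,\beta)$ be an $[\mathbf i_0]$-minimal pair for $\gamma$ and set $\Omega_{[\mathbf i_0]}(\alpha)=(i,p)$, $\Omega_{[\mathbf i_0]}(\beta)=(j,q)$. Then, for some $\ell\in\mathbb Z_{\ge1}$, one of the following holds: (i) $(i,p)=(n+1,r+2\ell)$ and $(j,q)=(\ell,\,r-\tfrac12-(n-\ell))$; (ii) $(i,p)=(n+1,r+2\ell)$ and $(j,q)=(2n+2-\ell,\,r-\tfrac12-(n-\ell))$; (iii) $(i,p)=(\ell,\,r+\tfrac12+(n-\ell))$ and $(j,q)=(n+1,r-2\ell)$; (iv) $(i,p)=(2n+2-\ell,\,r+\tfrac12+(n-\ell))$ and $(j,q)=(n+1,r-2\ell)$.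
   Context: Let $I=\{1,\dots,2n+1\}$, $W$ the Weyl group of type $A_{2n+1}$ with simple reflections $s_i$, simple roots $\Pi=\{\alpha_i\}$, positive roots $\Phi^+$, longest element $w_0$ of length $N$. Reduced words of $w_0$ are commutation equivalent if related by swapping neighbouring letters $i,j$ with $|i-j|\ge2$; $[\mathbf i]$ is the commutation class. $i$ is a sink (resp. source) of $[\mathbf i]$ if some word in the class starts (resp. ends) with $i$. With $i^*=2n+2-i$, reflection functors: if $i$ is a sink and $i\,i_2\cdots i_N\in[\mathbf i]$, $[\mathbf i]r_i=[i_2\cdots i_N\,i^*]$; if $i$ is a source and $i_1\cdots i_{N-1}i\in[\mathbf i]$, $r_i[\mathbf i]=[i^*i_1\cdots i_{N-1}]$; otherwise unchanged. Put $i^\vee=2n+2-i$; $(\cdot)^{k\vee}$ applies $\vee$ letterwise $k$ times. A class is twisted adapted if obtained by a sequence of reflection functors from the class of the reduced word $\prod_{k=0}^{2n}(1\,2\cdots n{+}1)^{k\vee}$ of $w_0$. For a reduced word $\mathbf j=i_1\cdots i_N$ put $\beta^{\mathbf j}_k=s_{i_1}\cdots s_{i_{k-1}}(\alpha_{i_k})$. The quiver $\Upsilon_{[\mathbf i_0]}$ has vertex set $\Phi^+$; $\beta^{\mathbf i_0}_k$ has residue $i_k$; there is an arrow $\beta_k\to\beta_j$ iff $|i_k-i_j|=1$, $j=\max\{j'<k:i_{j'}=i_j\}$, $k=\min\{k'>j:i_{k'}=i_k\}$. A vertex is non-induced if its residue is $n+1$ (such vertices are automatically called central). Coordinates. Let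 $P$ delete letters $n+1$ and replace each letter $j\ge n+2$ by $j-1$. There is a unique Dynkin quiver $Q$ of type $A_{2n}$ such that $P(\mathbf i_0)$ is a reduced word of the longest element of type $A_{2n}$ adapted to $Q$ (each $k$-th letter is a sink of the quiver obtained from $Q$ by reversing successively all arrows at the preceding letters). Fix $\xi$ on vertices of $Q$ with $\xi(j)=\xi(i)+1$ for each arrow $i\to j$. The $k$-th root of residue $i\le n$ (in the order of $\mathbf i_0$) has coordinate $\Omega_{[\mathbf i_0]}=(i,\xi(i)-2(k-1))$; the $k$-th root of residue $i\ge n+2$ has coordinate $(i,\xi(i-1)-2(k-1))$; a root of residue $n+1$ has coordinate $(n+1,p+\frac12)$ if it receives an arrow from a vertex $(j,p)$, and $(n+1,p-\frac12)$ if it has an arrow to a vertex $(j,p)$. Minimal pairs. A sequence is a function $\underline m:\Phi^+\to\mathbb Z_{\ge0}$ with weight $\sum\underline m(\beta)\beta$. $\underline m'<^{\mathtt b}_{\mathbf j}\underline m$ iff there are $k\le s$ with equal values at $\beta^{\mathbf j}_t$ for $t<k$ and $t>s$, and $\underline m'(\beta^{\mathbf j}_k)<\underline m(\beta^{\mathbf j}_k)$, $\underline m'(\beta^{\mathbf j}_s)<\underline m(\beta^{\mathbf j}_s)$; $\underline m'\prec^{\mathtt b}_{[\mathbf i_0]}\underline m$ iff this holds for all $\mathbf j\in[\mathbf i_0]$. A pair $(\alpha,\beta)$ of distinct roots is identified with its indicator function and is written so that $\alpha$ precedes $\beta$ in the order $\beta^{\mathbf j}_1,\dots,\beta^{\mathbf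 j}_N$ (when $\alpha+\beta\in\Phi^+$ this does not depend on $\mathbf j\in[\mathbf i_0]$). A root $\gamma$ is identified with its indicator function. A pair $(\alpha,\beta)$ with $\alpha+\beta=\gamma$ is $[\mathbf i_0]$-minimal for $\gamma$ if $\gamma\prec^{\mathtt b}_{[\mathbf i_0]}(\alpha,\beta)$ and there is no sequence $\underline m'$ of weight $\gamma$ with $\gamma\prec^{\mathtt b}_{[\mathbf i_0]}\underline m'\prec^{\mathtt b}_{[\mathbf i_0]}(\alpha,\beta)$. *)

(* Defs.v *)
From Stdlib Require Import Relation_Operators.
From mathcomp Require Import all_boot all_order all_algebra all_fingroup.

Set Implicit Arguments.
Unset Strict Implicit.
Unset Printing Implicit Defensive.

Import GRing.Theory.
Local Open Scope ring_scope.

(* The Weyl group of type A_m is the symmetric group on the coordinates of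
   Z^(m+1), with alpha_i = e_i - e_(i+1).  Letters are natural numbers in
   {1, ..., m}, whereas coordinates are indexed from 0, so letter i exchanges
   the coordinates i.-1 and i. *)

Definition word := seq nat.

Definition is_word (m : nat) (w : word) : bool :=
  all (fun i => 0 < i <= m)%N w.

Definition simple_perm (m i : nat) : 'S_m.+1 := tperm (inord i.-1) (inord i).

Definition word_perm (m : nat) (w : word) : 'S_m.+1 :=
  (\prod_(i <- w) simple_perm m i)%g.

Definition reduced (m : nat) (w : word) : Prop :=
  is_word m w /\
  forall v, is_word m v -> word_perm m v = word_perm m w -> (size w <= size v)%N.

(* w is a reduced word of w_0, the element of maximal length *)
Definition longest_word (m : nat) (w : word) : Prop :=
  reduced m w /\ forall v, reduced m v -> (size v <= size w)%N.

(* The pair (a, b) with a < b stands for e_a - e_b. *)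
Definition posroot (m : nat) := {x : 'I_m.+1 * 'I_m.+1 | (x.1 < x.2)%N}.

Definition evec (m : nat) (a : 'I_m.+1) : 'rV[int]_m.+1 := delta_mx ord0 a.

Definition rootvec (m : nat) (b : posroot m) : 'rV[int]_m.+1 :=
  evec (val b).1 - evec (val b).2.

Definition simple_root (m i : nat) : 'rV[int]_m.+1 :=
  evec (inord i.-1) - evec (inord i).

Definition is_simple (m : nat) (b : posroot m) : Prop :=
  exists2 i : nat, (0 < i <= m)%N & rootvec b = simple_root m i.

Definition reflection (m i : nat) (v : 'rV[int]_m.+1) : 'rV[int]_m.+1 :=
  col_perm (simple_perm m i) v.

(* s_(i_1) ... s_(i_(k-1)) (alpha_(i_k)), with k counted from 0 *)
Definition root_at (m : nat) (w : word) (k : nat) : 'rV[int]_m.+1 :=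
  foldr (@reflection m) (simple_root m (nth 0%N w k)) (take k w).

(* For a reduced word w of w_0, every positive root is root_at m w k for a unique
   k < size w; pos w b is this k. *)
Definition pos (m : nat) (w : word) (b : posroot m) : nat :=
  index (rootvec b) (mkseq (root_at m w) (size w)).

Definition residue (m : nat) (w : word) (b : posroot m) : nat :=
  nth 0%N w (pos w b).

Inductive comm_step : word -> word -> Prop :=
| CommStep (u v : word) (i j : nat) :
    (i.+2 <= j)%N || (j.+2 <= i)%N ->
    comm_step (u ++ i :: j :: v) (u ++ j :: i :: v).

(* comm_step is symmetric, so this is an equivalence relation; comm w v means
   that v belongs to the class [w]. *)
Definition comm : word -> word -> Prop := clos_refl_trans word comm_step.

Definition is_sink_of (i : nat) (w : word) : Prop := exists v, comm w (i :: v).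
Definition is_source_of (i : nat) (w : word) : Prop := exists v, comm w (rcons v i).

(* In type A_(2n+1) the two involutions i^* and i^\vee are both this one. *)
Definition dual (n i : nat) : nat := (n.*2.+2 - i)%N.

(* reflect_right n i w v : [w] r_i = [v] *)
Inductive reflect_right (n i : nat) (w v : word) : Prop :=
| RightSink (u : word) : comm w (i :: u) -> comm (rcons u (dual n i)) v ->
    reflect_right n i w v
| RightId : ~ is_sink_of i w -> comm w v -> reflect_right n i w v.

(* reflect_left n i w v : r_i [w] = [v] *)
Inductive reflect_left (n i : nat) (w v : word) : Prop :=
| LeftSource (u : word) : comm w (rcons u i) -> comm (dual n i :: u) v ->
    reflect_left n i w v
| LeftId : ~ is_source_of i w -> comm w v -> reflect_left n i w v.

Definition base_word (n : nat) : word :=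
  flatten [seq map (iter k (dual n)) (iota 1 n.+1) | k <- iota 0 n.*2.+1].

(* twisted_adapted n w : the class [w] is twisted adapted *)
Inductive twisted_adapted (n : nat) : word -> Prop :=
| TABase (w : word) : comm (base_word n) w -> twisted_adapted n w
| TARight (i : nat) (w v : word) : (0 < i <= n.*2.+1)%N ->
    twisted_adapted n w -> reflect_right n i w v -> twisted_adapted n v
| TALeft (i : nat) (w v : word) : (0 < i <= n.*2.+1)%N ->
    twisted_adapted n w -> reflect_left n i w v -> twisted_adapted n v.

(* the arrow beta_k -> beta_j; the last two clauses unfold the max and the min *)
Definition pos_arrow (w : word) (k j : nat) : Prop :=
  [/\ (j < k < size w)%N,
      nth 0%N w k = (nth 0%N w j).+1 \/ nth 0%N w j = (nth 0%N w k).+1,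
      forall j', (j < j' < k)%N -> nth 0%N w j' <> nth 0%N w j
    & forall k', (j < k' < k)%N -> nth 0%N w k' <> nth 0%N w k].

Definition upsilon_arrow (m : nat) (w : word) (b c : posroot m) : Prop :=
  pos_arrow w (pos w b) (pos w c).

Definition non_induced (n : nat) (w : word) (b : posroot n.*2.+1) : Prop :=
  residue w b = n.+1.

(* Q i j : there is an arrow i -> j *)
Definition dynkin_quiver (m : nat) (Q : rel nat) : Prop :=
  (forall i j, Q i j ->
     [&& 0 < i <= m, 0 < j <= m & (j == i.+1) || (i == j.+1)]%N) /\
  (forall i, (0 < i < m)%N -> Q i i.+1 (+) Q i.+1 i).

Definition quiver_sink (Q : rel nat) (i : nat) : Prop := forall j, ~~ Q i j.

Definition reverse_at (i : nat) (Q : rel nat) : rel nat :=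
  fun a b => if (a == i) || (b == i) then Q b a else Q a b.

Fixpoint adapted (Q : rel nat) (w : word) : Prop :=
  if w is i :: w' then quiver_sink Q i /\ adapted (reverse_at i Q) w' else True.

Definition height_function (Q : rel nat) (xi : nat -> int) : Prop :=
  forall i j, Q i j -> xi j = xi i + 1.

Definition project (n : nat) (w : word) : word :=
  [seq if (j <= n)%N then j else j.-1 | j <- w & j != n.+1].

(* Q is the Dynkin quiver of type A_(2n) attached to the class of w *)
Definition quiver_of (n : nat) (w : word) (Q : rel nat) : Prop :=
  [/\ dynkin_quiver n.*2 Q, longest_word n.*2 (project n w)
    & adapted Q (project n w)].

(* k - 1 when b is the k-th root of its residue *)
Definition rank_in_residue (m : nat) (w : word) (b : posroot m) : nat :=
  count_mem (residue w b) (take (pos w b) w).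

(* Omega w xi b c : the coordinate of b is c *)
Inductive Omega (n : nat) (w : word) (xi : nat -> int) (b : posroot n.*2.+1) :
    nat * rat -> Prop :=
| OmegaLow : (residue w b <= n)%N ->
    Omega w xi b
      (residue w b, (xi (residue w b))%:~R - 2 * (rank_in_residue w b)%:R)
| OmegaHigh : (n.+2 <= residue w b)%N ->
    Omega w xi b
      (residue w b, (xi (residue w b).-1)%:~R - 2 * (rank_in_residue w b)%:R)
| OmegaIn (c : posroot n.*2.+1) (j : nat) (p : rat) : residue w b = n.+1 ->
    upsilon_arrow w c b -> Omega w xi c (j, p) ->
    Omega w xi b (n.+1, p + 1 / 2)
| OmegaOut (c : posroot n.*2.+1) (j : nat) (p : rat) : residue w b = n.+1 ->
    upsilon_arrow w b c -> Omega w xi c (j, p) ->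
    Omega w xi b (n.+1, p - 1 / 2).

Definition rootseq (m : nat) := {ffun posroot m -> nat}.

Definition weight (m : nat) (f : rootseq m) : 'rV[int]_m.+1 :=
  \sum_(b : posroot m) rootvec b *+ f b.

Definition root_ind (m : nat) (c : posroot m) : rootseq m :=
  [ffun b => nat_of_bool (b == c)].

Definition pair_ind (m : nat) (a c : posroot m) : rootseq m :=
  [ffun b => nat_of_bool ((b == a) || (b == c))].

(* f <^b_w g; the bounds k <= s are the positions of the roots x and y *)
Definition bilex_lt (m : nat) (w : word) (f g : rootseq m) : Prop :=
  exists x y : posroot m,
    [/\ (pos w x <= pos w y)%N,
        forall z, (pos w z < pos w x)%N || (pos w y < pos w z)%N -> f z = g z,
        (f x < g x)%N
      & (f y < g y)%N].

Definition class_lt (m : nat) (w : word) (f g : rootseq m) : Prop :=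
  forall v, comm w v -> bilex_lt v f g.

Definition minimal_pair (m : nat) (w : word) (a b c : posroot m) : Prop :=
  [/\ a != b /\ (pos w a < pos w b)%N,
      rootvec a + rootvec b = rootvec c,
      class_lt w (root_ind c) (pair_ind a b)
    & ~ exists f : rootseq m,
        [/\ weight f = rootvec c, class_lt w (root_ind c) f
          & class_lt w f (pair_ind a b)]].

(* Main.v *)
From Stdlib Require Import Relation_Operators.
Require Import Defs.
From mathcomp Require Import all_boot all_order all_algebra all_fingroup.
From mathcomp Require Import zify ring lra.
Import Order.TTheory GRing.Theory Num.Theory.
Local Open Scope ring_scope.

(** A reduced word of the longest element is a wiring diagram on the strands
    0, ..., 2n+1; the root at the k-th letter is e_a - e_b where a and b are the
    strands crossing there ([root_at_track]).  In a twisted adapted word the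
    letters of {n, n+1, n+2} are alternately equal to and different from n+1
    ([twisted_adapted_word]: this survives the reflection functors because the
    number of these letters is even).  Combined with the adaptedness of the
    projected word, this makes every letter a local maximum of a height
    function that drops by 2 at each occurrence of the letter, and by 1 for the
    letter n+1 ([peak_word_adapted]).

    The geometry then becomes rigid.  One strand c bounces between the positions
    n and n+1, and it takes part in all the crossings at level n+1, so the
    non-induced roots are those involving e_c ([strand_residue]).  Every other
    strand follows a straight line in the plane (level, coordinate), reflected
    at the bottom and top levels; level plus coordinate on an ascending piece,
    and coordinate minus level on a descending one, define a phase that is
    constant modulo the length 4n+2 of a full trip
    ([phase_lower]).

    If gamma is the crossing of c and a, then a pair summing to gamma consists
    of the crossing of c with a further strand k and of the crossing of a with
    k.  The coordinates of the two crossings with c give the phases of a and k;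
    the phases give the level of the crossing of a and k, and its coordinate
    modulo 4n+2.  The word contains only 2n+1 letters n+1, which leaves a window
    for the coordinate narrow enough to determine it ([crossing_arith]).  The
    position of gamma between alpha and beta separates the first two cases from
    the last two, and the level of the induced root separates the two cases of
    each group.

    Half-integral coordinates are avoided by doubling all heights and levels. *)

(** * Strands, heights and phases *)

Definition swap_pos (i x : nat) : nat :=
  if x == i.-1 then i else if x == i then i.-1 else x.

Definition track (w : word) (x : nat) : nat :=
  foldl (fun y i => swap_pos i y) x w.

Lemma swap_posK (i : nat) : involutive (swap_pos i).
Proof.
move=> x; rewrite {2}/swap_pos; do 2 ?[case: ifP => ?]; rewrite /swap_pos;
  by do 2 ?[case: ifP => ?]; lia.
Qed.

Lemma track_cat (u v : word) (x : nat) : track (u ++ v) x = track v (track u x).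
Proof. exact: foldl_cat. Qed.

Lemma track_inj (w : word) : injective (track w).
Proof.
elim: w => // i w IHw x y /IHw; exact: inv_inj (swap_posK i) x y.
Qed.

(** The letter n+1 occurs once for each occurrence of n and each occurrence of
    n+2, so its height must drop half as fast to stay level with theirs. *)
Definition drop_size (n i : nat) : int := if i == n.+1 then 2 else 4.

Definition lower (n i : nat) (g : nat -> int) : nat -> int :=
  fun j => if j == i then g j - drop_size n i else g j.

Definition heights_after (n : nat) (g : nat -> int) (w : word) : nat -> int :=
  foldl (fun h i => lower n i h) g w.

Definition is_peak (n : nat) (g : nat -> int) (i : nat) : Prop :=
  forall j, (0 < j <= n.*2.+1)%N -> (j == i.+1) || (i == j.+1) -> g j < g i.

Fixpoint peak_word (n : nat) (g : nat -> int) (w : word) : Prop :=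
  if w is i :: w' then is_peak n g i /\ peak_word n (lower n i g) w' else True.

(** The shape of the height functions met along a twisted adapted word, where [c]
    is the position of the bouncing strand.  Around n+1 the level n or n+2
    adjacent to [c] has height one less than the central height; on
    the other side it is one more (its letter comes before the next n+1) or
    three less (the next n+1 comes first). *)
Definition balanced (n : nat) (g : nat -> int) (c : nat) : Prop :=
  (forall i, (0 < i < n.*2.+1)%N -> i != n -> i != n.+1 ->
     g i.+1 = g i + 2 \/ g i.+1 = g i - 2) /\
  ([/\ c = n, g n = g n.+1 - 1 & g n.+2 = g n.+1 + 1 \/ g n.+2 = g n.+1 - 3] \/
   [/\ c = n.+1, g n.+2 = g n.+1 - 1 & g n = g n.+1 + 1 \/ g n = g n.+1 - 3]).

(** At a peak n+1, both neighbours lie below, which forces the offsets -1 and -3;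
    at a peak n or n+2, [c] is on the opposite side, so that it is not moved. *)
Lemma balanced_lower (n : nat) (g : nat -> int) (c i : nat) :
  (1 <= n)%N -> (0 < i <= n.*2.+1)%N -> is_peak n g i ->
  balanced n g c -> balanced n (lower n i g) (swap_pos i c).
Proof.
move=> n1 hi pk [hg hc]; split.
  move=> j hj jn jn1; have := hg j hj jn jn1.
  rewrite /lower /drop_size.
  have := pk j; have := pk j.+1.
  have [e h1 h2|ji] := eqVneq j.+1 i.
    subst i; have -> : j == j.+1 = false by lia.
    have -> : j.+1 == n.+1 = false by lia.
    by have := h2; lia.
  have [e h1 h2|ji' _ _ //] := eqVneq j i.
  subst j; have -> : i == n.+1 = false by lia.
  by have := h1; lia.
have := pk n.+2; have := pk n.+1; have := pk n.
have [-> p1 _ p2|ni1] := eqVneq i n.+1.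
  have -> : lower n n.+1 g n = g n by rewrite /lower; case: ifP; lia.
  have -> : lower n n.+1 g n.+2 = g n.+2 by rewrite /lower; case: ifP; lia.
  have -> : lower n n.+1 g n.+1 = g n.+1 - 2 by rewrite /lower /drop_size !eqxx.
  rewrite /swap_pos; case: hc => -[-> e1 e2].
    by right; rewrite eqxx; split=> //; lia.
  by left; rewrite eqxx; case: eqP => ?; first lia; split=> //; lia.
have eg : lower n i g n.+1 = g n.+1 by rewrite /lower; case: ifP; lia.
rewrite eg.
have [e _ p2 p3|nin] := eqVneq i n.
  subst i.
  have -> : lower n n g n = g n - 4 by
    rewrite /lower /drop_size eqxx; case: ifP; lia.
  have -> : lower n n g n.+2 = g n.+2 by rewrite /lower; case: ifP; lia.
  case: hc => -[-> e1 e2]; first lia.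
  right; rewrite /swap_pos; do 2 (case: ifP => ?; first lia); split=> //; lia.
have -> : lower n i g n = g n by rewrite /lower; case: ifP; lia.
have [e p3 p2 p1|nin2 _ _ _] := eqVneq i n.+2.
  subst i.
  have -> : lower n n.+2 g n.+2 = g n.+2 - 4.
    by rewrite /lower /drop_size eqxx; case: ifP; lia.
  case: hc => -[-> e1 e2]; last lia.
  left; rewrite /swap_pos; do 2 (case: ifP => ?; first lia); split=> //; lia.
have -> : lower n i g n.+2 = g n.+2 by rewrite /lower; case: ifP; lia.
case: hc => -[-> e1 e2]; [left|right]; rewrite /swap_pos;
  by do 2 (case: ifP => ?; first lia).
Qed.

(** Doubled levels of the diagram with the bouncing strand removed: the levels n and
    n+2 become consecutive, and n+1 lies half-way between them. *)
Definition level (n i : nat) : int :=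
  if (i <= n)%N then i.*2%:Z else if i == n.+1 then n.*2.+1%:Z else i.*2%:Z - 2.

(** The strand at position [y] lies between the levels [y] and [y.+1]; it next
    crosses at the higher of the two, the bottom and top positions having only
    one level to cross. *)
Definition rises (n : nat) (g : nat -> int) (y : nat) : bool :=
  (y == 0%N) || ((y < n.*2.+1)%N && (g y < g y.+1)).

(** The height at level 0 of the line followed by the strand; a strand rising from
    level 0 and the same strand coming back to it differ by a full trip, hence
    the congruence [same_phase]. *)
Definition phase (n : nat) (g : nat -> int) (y : nat) : int :=
  if rises n g y then g y.+1 + level n y.+1 else g y - level n y.

Definition same_phase (n : nat) (x y : int) : Prop :=
  exists z : int, x = y + (8 * n%:Z + 4) * z.

Lemma lower_neq (n i j : nat) (g : nat -> int) :
  j != i -> lower n i g j = g j.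
Proof. by rewrite /lower => /negbTE ->. Qed.

Lemma lower_eq (n i : nat) (g : nat -> int) :
  lower n i g i = g i - drop_size n i.
Proof. by rewrite /lower eqxx. Qed.

Lemma drop_sizeP (n i : nat) :
  (i == n.+1 /\ drop_size n i = 2) \/ (i != n.+1 /\ drop_size n i = 4).
Proof. by rewrite /drop_size; case: ifP => ?; [left|right]. Qed.

Lemma same_phase_refl (n : nat) (x y : int) : x = y -> same_phase n x y.
Proof. by move=> ->; exists 0; rewrite mulr0 addr0. Qed.

Lemma phase_rising (n : nat) (g : nat -> int) (i : nat) :
  (0 < i <= n.*2.+1)%N -> is_peak n g i ->
  phase n g i.-1 = g i + level n i.
Proof.
move=> hi pk; have := pk i.-1; rewrite /phase /rises prednK; last lia.
by case: ifP => //; lia.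
Qed.

Lemma phase_falling (n : nat) (g : nat -> int) (i : nat) :
  (0 < i <= n.*2.+1)%N -> is_peak n g i ->
  phase n g i = g i - level n i.
Proof.
move=> hi pk; have := pk i.+1; rewrite /phase /rises.
by case: ifP => //; lia.
Qed.

(** Straightness: after crossing at level [i] the strand next crosses at the
    adjacent level, whose height is smaller by exactly the difference of levels,
    so the phase is unchanged.  Only the reflection at the top shifts it, by the
    modulus. *)
Lemma phase_lower (n : nat) (g : nat -> int) (c i y : nat) :
  (1 <= n)%N -> (0 < i <= n.*2.+1)%N -> is_peak n g i -> balanced n g c ->
  y != c ->
  same_phase n (phase n (lower n i g) (swap_pos i y)) (phase n g y).
Proof.
move=> n1 hi pk [hg hc] yc.
have [ey|yi1] := eqVneq y i.-1.
  subst y; rewrite (phase_rising n g i) // /swap_pos eqxx /phase /rises lower_eq.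
  rewrite lower_neq; last lia.
  have [ei|i2n] := eqVneq i n.*2.+1.
    (* the top level, where an ascending strand turns back *)
    exists (-1); rewrite ei ltnn /= /drop_size /level.
    by do 4 ?[case: ifP => ?]; lia.
  apply: same_phase_refl.
  have := hg i; have := pk i.+1; have := drop_sizeP n i; rewrite /level.
  have [e|] := eqVneq i n.
    by subst i; case: hc => -[] /=; do 6 ?[case: ifP => ?]; lia.
  have [e|] := eqVneq i n.+1.
    by subst i; case: hc => -[] /=; do 6 ?[case: ifP => ?]; lia.
  by do 6 ?[case: ifP => ?]; lia.
have [ey|yi] := eqVneq y i.
  subst y; rewrite (phase_falling n g i) // /swap_pos (negbTE yi1) eqxx.
  rewrite /phase /rises /=.
  rewrite (prednK (_ : 0 < i)%N); last lia.
  rewrite lower_eq lower_neq; last lia.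
  apply: same_phase_refl.
  have := hg i.-1; have := pk i.-1; have := drop_sizeP n i.
  rewrite /level prednK; last lia.
  have [e|] := eqVneq i n.
    by subst i; case: hc => -[] /=; do 6 ?[case: ifP => ?]; lia.
  have [e|] := eqVneq i n.+1.
    by subst i; case: hc => -[] /=; do 6 ?[case: ifP => ?]; lia.
  have [e|] := eqVneq i n.+2.
    by subst i; case: hc => -[] /=; do 6 ?[case: ifP => ?]; lia.
  by do 6 ?[case: ifP => ?]; lia.
apply: same_phase_refl; rewrite /swap_pos (negbTE yi1) (negbTE yi) /phase /rises.
by rewrite !lower_neq //; lia.
Qed.
Lemma heights_after_cons (n : nat) (g : nat -> int) (i : nat) (u : word) :
  heights_after n g (i :: u) = heights_after n (lower n i g) u.
Proof. by []. Qed.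

Lemma heights_afterE (n : nat) (g : nat -> int) (u : word) (i : nat) :
  heights_after n g u i = g i - drop_size n i * (count_mem i u)%:Z.
Proof.
elim: u g => [|j u IHu] g; first by rewrite mulr0 subr0.
rewrite heights_after_cons IHu /= /lower eq_sym; case: eqP => [->|_] //=.
by rewrite PoszD; ring.
Qed.

Lemma same_phase_trans (n : nat) (x y z : int) :
  same_phase n x y -> same_phase n y z -> same_phase n x z.
Proof. by move=> [a ->] [b ->]; exists (a + b); ring. Qed.

Lemma peak_word_after (n : nat) (g : nat -> int) (w : word) (c t : nat) :
  (1 <= n)%N -> is_word n.*2.+1 w -> peak_word n g w -> balanced n g c ->
  (t < size w)%N ->
  [/\ is_peak n (heights_after n g (take t w)) (nth 0%N w t),
      balanced n (heights_after n g (take t w)) (track (take t w) c)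
    & forall y, y != c ->
      same_phase n (phase n (heights_after n g (take t w)) (track (take t w) y))
        (phase n g y)].
Proof.
move=> n1; elim: w g c t => [|i w IHw] g c t //= /andP[hi hw] [pk fw] bal.
case: t => [|t] ht.
  by split=> // y _; rewrite take0; exact: same_phase_refl.
have bal' := balanced_lower n g c i n1 hi pk bal.
have [p1 p2 p3] := IHw _ _ _ hw fw bal' ht.
split=> // y yc; apply: same_phase_trans (phase_lower n g c i y n1 hi pk bal yc).
by apply: p3; rewrite (inj_eq (inv_inj (swap_posK i))).
Qed.

(** * Heights of an adapted word *)

Lemma sink_height (m : nat) (Q : rel nat) (xi : nat -> int) (i j : nat) :
  dynkin_quiver m Q -> height_function Q xi -> quiver_sink Q i ->
  (0 < i <= m)%N -> (0 < j <= m)%N -> (j == i.+1) || (i == j.+1) ->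
  xi i = xi j + 1.
Proof.
move=> [_ dQ] hxi si hi hj /orP[] /eqP e; apply: hxi.
  have := dQ i; rewrite -e (negbTE (si j)) /= => -> //; lia.
have := dQ j; rewrite -e (negbTE (si j)) addbF => -> //; lia.
Qed.

Lemma dynkin_reverse (m : nat) (Q : rel nat) (i : nat) :
  dynkin_quiver m Q -> dynkin_quiver m (reverse_at i Q).
Proof.
move=> [Qr Qa]; split=> [a b|a ha].
  by rewrite /reverse_at; case: ifP => _ /Qr /and3P[? ? ?];
    apply/and3P; split=> //; rewrite orbC.
have := Qa a ha; rewrite /reverse_at orbC.
by case: ifP => _ //; rewrite addbC.
Qed.

Lemma height_reverse (m : nat) (Q : rel nat) (xi : nat -> int) (i : nat) :
  dynkin_quiver m Q -> height_function Q xi -> quiver_sink Q i ->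
  height_function (reverse_at i Q) (fun j => if j == i then xi j - 2 else xi j).
Proof.
move=> [Qr _] hxi si a b; rewrite /reverse_at.
have [-> /= Qbi|ai] := eqVneq a i.
  have [e|bi] := eqVneq b i; first by have := si i; move: Qbi; rewrite e => ->.
  by rewrite (hxi _ _ Qbi); lia.
have [-> /= Qia|bi /=] := eqVneq b i; first by have := si a; rewrite Qia.
exact: hxi.
Qed.

Definition central_bits (n : nat) (w : word) : seq bool :=
  [seq x == n.+1 | x <- w & (n <= x <= n.+2)%N].

Fixpoint alternates (b : bool) (s : seq bool) : bool :=
  if s is x :: s' then (x == b) && alternates (~~ b) s' else true.

(** The sinks of the successive quivers are the local maxima of the successive
    height functions on the induced levels.  The central height starts half a
    unit above or below the larger of its neighbours, according to whether the
    first letter of {n, n+1, n+2} is n+1 or not. *)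
Lemma peak_word_adapted (n : nat) (w : word) (Q : rel nat) (xi : nat -> int)
    (b : bool) (g : nat -> int) :
  (1 <= n)%N -> is_word n.*2.+1 w -> alternates b (central_bits n w) ->
  dynkin_quiver n.*2 Q -> height_function Q xi -> adapted Q (project n w) ->
  (forall i, (0 < i <= n)%N -> g i = 2 * xi i) ->
  (forall i, (n < i <= n.*2)%N -> g i.+1 = 2 * xi i) ->
  g n.+1 = 2 * Num.max (xi n) (xi n.+1) + (if b then 1 else -1) ->
  peak_word n g w.
Proof.
move=> n1; elim: w Q xi b g => [|i w IHw] Q xi b g //= /andP[hi hw].
rewrite /central_bits /project /=.
have [->|ni] /= := eqVneq i n.+1.
  rewrite ifT; last lia.
  rewrite /= eqxx => /andP[/eqP <- hb] dQ hxi aQ g1 g2 g3; split.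
    move=> j hj jn; have := g1 n; have := g2 n.+1.
    have [->|->] : j = n \/ j = n.+2 by lia.
      by lia.
    by lia.
  apply: (IHw Q xi false) => // [j hj|j hj|].
  - by rewrite lower_neq ?g1 //; lia.
  - by rewrite lower_neq ?g2 //; lia.
  - by rewrite lower_eq g3 /drop_size eqxx; lia.
move=> hb dQ hxi [si aQ] g1 g2 g3.
set i' := if (i <= n)%N then i else i.-1 in si aQ.
have hi' : (0 < i' <= n.*2)%N by rewrite /i'; case: ifP; lia.
have gi : g i = 2 * xi i'.
  rewrite /i'; case: ifP => h; first by apply: g1; lia.
  by rewrite -[in LHS](prednK (_ : 0 < i)%N) ?g2; lia.
have nb j : (0 < j <= n.*2)%N -> (j == i'.+1) || (i' == j.+1) ->
  xi i' = xi j + 1 by exact: (sink_height n.*2 Q).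
have bb : (i == n) || (i == n.+2) ->
    b = false /\ alternates true (central_bits n w).
  move=> hm; move: hb; rewrite ifT /=; last lia.
  by rewrite (negbTE ni) => /andP[/eqP <-].
have bb' : (i != n) -> (i != n.+2) -> alternates b (central_bits n w).
  by move=> ? ?; move: hb; rewrite ifF /=; last lia.
have hdrop : drop_size n i = 4 by rewrite /drop_size (negbTE ni).
split.
  move=> j hj ji; rewrite gi.
  have [ej|jn] := eqVneq j n.+1.
    subst j; have [|eb _] := bb; first lia.
    rewrite {}eb in g3.
    have := nb n; have := nb n.+1; rewrite g3 /i' /=.
    have [e|e] : i = n \/ i = n.+2 by lia.
      by rewrite e leqnn; lia.
    by rewrite e /= ifF; lia.
  have := nb j; have := nb j.-1; have := g1 j; have := g2 j.-1.
  rewrite (prednK (_ : 0 < j)%N); last lia.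
  by rewrite /i'; case: ifP; lia.
apply: (IHw (reverse_at i' Q) (fun j => if j == i' then xi j - 2 else xi j)
  (if (i == n) || (i == n.+2) then true else b)) => //.
- case: ifP => hm; first by case: (bb hm).
  by apply: bb'; lia.
- exact: dynkin_reverse.
- exact: (height_reverse n.*2).
- move=> j hj; have := g1 j hj; have := nb j.
  have [e|ji] := eqVneq j i; last rewrite lower_neq //.
    by subst j; rewrite lower_eq hdrop (_ : i' = i) ?eqxx /i' ?ifT; lia.
  by rewrite (_ : j == i' = false) // /i'; case: ifP; lia.
- move=> j hj; have := g2 j hj.
  have [e|ji] := eqVneq j.+1 i; last rewrite lower_neq //.
    by subst i; rewrite lower_eq hdrop (_ : i' = j) ?eqxx /i' ?ifF /=; lia.
  by rewrite (_ : j == i' = false) // /i'; case: ifP; lia.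
- rewrite lower_neq; last lia.
  rewrite g3; have := nb n; have := nb n.+1; move: bb; rewrite /i'.
  have [e|?] := eqVneq i n.
    subst i => -[] // -> _; rewrite leqnn !eqxx /=.
    have -> : n.+1 == n = false by lia.
    by lia.
  have [e|?] := eqVneq i n.+2.
    subst i => -[] // -> _ /=.
    have -> : (n.+1 < n)%N = false by lia.
    have -> : n == n.+1 = false by lia.
    by rewrite !eqxx ?orbT /=; lia.
  move=> _ _ _; rewrite -/i'.
  have -> : n == i' = false by rewrite /i'; case: ifP; lia.
  have -> : n.+1 == i' = false by rewrite /i'; case: ifP; lia.
  by rewrite /=; lia.
Qed.

(** The bouncing strand starts next to the lower of the levels n and n+2 when one
    of these levels is crossed before n+1, and next to the higher otherwise. *)
Lemma balanced_start (n : nat) (Q : rel nat) (xi : nat -> int) (b : bool) :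
  (1 <= n)%N -> dynkin_quiver n.*2 Q -> height_function Q xi ->
  exists g c,
    [/\ forall i, (0 < i <= n)%N -> g i = 2 * xi i,
        forall i, (n < i <= n.*2)%N -> g i.+1 = 2 * xi i,
        g n.+1 = 2 * Num.max (xi n) (xi n.+1) + (if b then 1 else -1)
      & balanced n g c].
Proof.
move=> n1 [_ dQ] hxi.
have adj i : (0 < i < n.*2)%N -> xi i.+1 = xi i + 1 \/ xi i.+1 = xi i - 1.
  move=> /dQ; case q: (Q i i.+1) => /=; first by left; exact: hxi.
  by move=> q'; right; rewrite (hxi _ _ q'); lia.
pose M : int := 2 * Num.max (xi n) (xi n.+1) + (if b then 1 else -1).
pose g i : int := if (i <= n)%N then 2 * xi i else
  if i == n.+1 then M else 2 * xi i.-1.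
have g1 i : (i <= n)%N -> g i = 2 * xi i by rewrite /g => ->.
have g2 i : (n < i)%N -> g i.+1 = 2 * xi i.
  by move=> h; rewrite /g ifF; last lia; rewrite ifF //; lia.
have g3 : g n.+1 = M by rewrite /g ltnn eqxx.
exists g, (if b == (xi n.+1 < xi n) then n else n.+1).
split=> //; try by [move=> i hi; apply: g1; lia | move=> i hi; apply: g2; lia].
split.
  move=> i hi ni ni1.
  have [h|h] := leqP i n.
    by rewrite !g1; [have := adj i; lia|lia|lia].
  have gi := g2 i h; have gi' := g2 i.-1.
  rewrite (prednK (_ : 0 < i)%N) in gi'; last lia.
  have := adj i.-1; rewrite (prednK (_ : 0 < i)%N); last lia.
  by lia.
rewrite g3 (g2 n.+1) // (g1 n) // /M.
have := adj n; case: (b) => /=; case: ifP => h1 h2; [left|right|left|right];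
  by split=> //; lia.
Qed.

(** * Twisted adapted words *)

Lemma comm_invariant (T : Type) (f : word -> T) (u v : word) :
  (forall u' v', comm_step u' v' -> f u' = f v') -> comm u v -> f u = f v.
Proof.
move=> H; elim=> [x y xy|x|x y z _ e1 _ e2]; [exact: H|by []|exact: etrans e1 e2].
Qed.

Lemma swap_pos_comm (i j x : nat) : (i.+2 <= j)%N || (j.+2 <= i)%N ->
  swap_pos i (swap_pos j x) = swap_pos j (swap_pos i x).
Proof.
move=> h; rewrite [swap_pos j x]/swap_pos [swap_pos i x]/swap_pos.
by do 4 ?[case: ifP => ?]; rewrite /swap_pos; do 4 ?[case: ifP => ?]; lia.
Qed.

Lemma comm_track (u v : word) : comm u v -> track u =1 track v.
Proof.
move=> uv x; apply: (@comm_invariant _ (track^~ x) u v) uv => _ _ [a b i j h].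
by rewrite !track_cat /= (swap_pos_comm i).
Qed.

Lemma comm_is_word (m : nat) (u v : word) :
  comm u v -> is_word m u = is_word m v.
Proof.
move: u v => u v; apply: comm_invariant => _ _ [a b i j _].
by rewrite /is_word !all_cat /=; congr (_ && _); rewrite andbCA.
Qed.

Lemma central_bits_cat (n : nat) (u v : word) :
  central_bits n (u ++ v) = central_bits n u ++ central_bits n v.
Proof. by rewrite /central_bits filter_cat map_cat. Qed.

(** Exchanging n and n+2 is the only commutation inside {n, n+1, n+2}, and it
    exchanges two equal bits. *)
Lemma comm_central_bits (n : nat) (u v : word) :
  comm u v -> central_bits n u = central_bits n v.
Proof.
apply: comm_invariant => _ _ [a b i j h].
rewrite !central_bits_cat; congr (_ ++ _); rewrite /central_bits /=.
case: ifP => hi; case: ifP => hj //=.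
by have -> : (i == n.+1) = (j == n.+1) by lia.
Qed.

Lemma swap_pos_dual (n i x : nat) : (0 < i <= n.*2.+1)%N -> (x <= n.*2.+1)%N ->
  swap_pos (dual n i) (n.*2.+1 - x) = (n.*2.+1 - swap_pos i x)%N.
Proof.
move=> hi hx; rewrite /swap_pos /dual.
by do 4 ?[case: ifP => ?]; lia.
Qed.

Lemma swap_pos_bound (m i x : nat) : (i <= m)%N -> (x <= m)%N ->
  (swap_pos i x <= m)%N.
Proof. by move=> hi hx; rewrite /swap_pos; do 2 ?[case: ifP => ?]; lia. Qed.

Lemma track_dual (n : nat) (w : word) (x : nat) :
  is_word n.*2.+1 w -> (x <= n.*2.+1)%N ->
  track (map (dual n) w) (n.*2.+1 - x) = (n.*2.+1 - track w x)%N.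
Proof.
elim: w x => //= i w IHw x /andP[hi hw] hx.
by rewrite swap_pos_dual // IHw // swap_pos_bound //; lia.
Qed.

Lemma central_bits_dual (n : nat) (w : word) :
  is_word n.*2.+1 w -> central_bits n (map (dual n) w) = central_bits n w.
Proof.
elim: w => //= i w IHw /andP[hi /IHw]; rewrite /central_bits /= => e.
have -> : (n <= dual n i <= n.+2)%N = (n <= i <= n.+2)%N by rewrite /dual; lia.
case: ifP => h //=; rewrite e; congr (_ :: _); rewrite /dual; lia.
Qed.

Lemma dual_word (n : nat) (w : word) :
  is_word n.*2.+1 w -> is_word n.*2.+1 (map (dual n) w).
Proof.
rewrite /is_word all_map; apply: sub_all => i /= hi; rewrite /dual; lia.
Qed.

Definition alternating (m : nat) (b : bool) : seq bool :=
  flatten (nseq m [:: b; ~~ b]).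

Lemma alternatingS (m : nat) (b : bool) :
  alternating m.+1 b = [:: b, ~~ b & alternating m b].
Proof. by []. Qed.

Lemma alternating_cons (m : nat) (b : bool) :
  b :: alternating m (~~ b) = rcons (alternating m b) b.
Proof.
rewrite /alternating; elim: m => //= m <-.
by case: b.
Qed.

Lemma alternates_alternating (m : nat) (b : bool) :
  alternates b (alternating m b).
Proof. by elim: m => //= m; case: b. Qed.

Lemma count_central_bits (n : nat) (w : word) :
  count id (central_bits n w) = count_mem n.+1 w.
Proof.
elim: w => // i w; rewrite /central_bits /=; case: ifP => h /= ->; first by [].
by have -> : i == n.+1 = false by lia.
Qed.

Lemma count_alternating (m : nat) (b : bool) : count id (alternating m b) = m.
Proof. by elim: m => //= m ->; case: b. Qed.

(** The properties of the base word that the reflection functors preserve and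
    that determine the geometry. *)
Definition twisted_word (n : nat) (w : word) : Prop :=
  [/\ is_word n.*2.+1 w,
      forall x, (x <= n.*2.+1)%N -> track w x = (n.*2.+1 - x)%N
    & exists b, central_bits n w = alternating n.*2.+1 b].

Lemma twisted_word_comm (n : nat) (u v : word) : comm u v -> twisted_word n u -> twisted_word n v.
Proof.
move=> uv [wu tu [b bu]]; split.
- by rewrite -(comm_is_word _ _ _ uv).
- by move=> x hx; rewrite -(comm_track _ _ uv) tu.
- by exists b; rewrite -(comm_central_bits _ _ _ uv).
Qed.

Lemma dual_mid (n i : nat) : (0 < i <= n.*2.+1)%N ->
  ((n <= dual n i <= n.+2)%N = (n <= i <= n.+2)%N) *
  ((dual n i == n.+1) = (i == n.+1)).
Proof. by rewrite /dual => h; split; lia. Qed.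

Lemma dualK (n i : nat) : (0 < i <= n.*2.+1)%N -> dual n (dual n i) = i.
Proof. by rewrite /dual; lia. Qed.

Lemma track_rcons (w : word) (i x : nat) : track (rcons w i) x = swap_pos i (track w x).
Proof. by rewrite -cats1 track_cat. Qed.

(** Conjugation by the longest element exchanges i and its dual, and the rotation
    of an alternating sequence of even length is alternating. *)
Lemma twisted_word_right (n i : nat) (u : word) :
  twisted_word n (i :: u) -> twisted_word n (rcons u (dual n i)).
Proof.
move=> [/= /andP[hi wu] tu [b bu]]; split.
- by rewrite /is_word all_rcons -/(is_word _ _) wu andbT /dual; lia.
- move=> x hx; rewrite track_rcons -[in LHS](swap_posK i x).
  have hx' : (swap_pos i x <= n.*2.+1)%N by apply: swap_pos_bound; lia.
  have := tu _ hx'; rewrite /= -/(track _ _) swap_posK => ->.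
  by rewrite swap_pos_dual // swap_posK.
- rewrite -cats1 central_bits_cat; move: bu; rewrite /central_bits /= !dual_mid //.
  case: ifP => h /=; last by rewrite cats0; exists b.
  rewrite dual_mid // alternatingS => -[-> ->]; exists (~~ b).
  by rewrite alternatingS negbK cats1 rcons_cons -alternating_cons.
Qed.

Lemma twisted_word_left (n i : nat) (u : word) :
  twisted_word n (rcons u i) -> twisted_word n (dual n i :: u).
Proof.
move=> [/=]; rewrite /is_word all_rcons => /andP[hi wu] tu [b bu]; split.
- by rewrite /is_word /= wu andbT /dual; lia.
- move=> x hx /=; rewrite -/(track _ _).
  have hd : (0 < dual n i <= n.*2.+1)%N by rewrite /dual; lia.
  have hx' : (swap_pos (dual n i) x <= n.*2.+1)%N by apply: swap_pos_bound; lia.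
  have := tu _ hx'; rewrite track_rcons => /(congr1 (swap_pos i)).
  rewrite swap_posK => ->.
  by rewrite -{1}(dualK n i) // swap_pos_dual // swap_posK.
- move: bu; rewrite -cats1 central_bits_cat /central_bits /= !dual_mid //.
  case: ifP => h /=; last by rewrite cats0; exists b.
  have := alternating_cons n.*2 (~~ b); rewrite negbK => e.
  rewrite dual_mid // cats1 alternatingS e -rcons_cons => /rcons_inj[-> ->].
  by exists (~~ b); rewrite alternatingS negbK.
Qed.

Definition coxeter_block (n : nat) (o : bool) : word :=
  if o then map (dual n) (iota 1 n.+1) else iota 1 n.+1.

Lemma base_wordE (n : nat) :
  base_word n = flatten [seq coxeter_block n (odd k) | k <- iota 0 n.*2.+1].
Proof.
congr flatten; apply: eq_map => k; rewrite /coxeter_block.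
have e x : x \in iota 1 n.+1 ->
    iter k (dual n) x = if odd k then dual n x else x.
  rewrite mem_iota => hx; elim: k => //= k ->.
  by case: (odd k) => //=; rewrite dualK //; lia.
case: ifP => h; last rewrite -[RHS]map_id.
  by apply/eq_in_map => x /e; rewrite h.
by apply/eq_in_map => x /e; rewrite h.
Qed.

Lemma is_word_iota (n : nat) : is_word n.*2.+1 (iota 1 n.+1).
Proof. by apply/allP => x; rewrite mem_iota; lia. Qed.

Lemma is_word_block (n : nat) (o : bool) : is_word n.*2.+1 (coxeter_block n o).
Proof.
by case: o; rewrite /coxeter_block; [apply: dual_word|]; exact: is_word_iota.
Qed.

Lemma track_iota (i m x : nat) : (0 < i)%N ->
  track (iota i m) x =
  if x == i.-1 then (i + m).-1 else if (i <= x < i + m)%N then x.-1 else x.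
Proof.
elim: m i x => [|m IHm] i x hi /=; first by do 2 ?[case: ifP => ?]; lia.
rewrite -/(track _ _) IHm // /swap_pos.
have [e|h1] := eqVneq x i.-1; first by rewrite /= eqxx; lia.
have [e|h2] := eqVneq x i; first by rewrite /=; do 5 ?[case: ifP => ?]; lia.
by rewrite /=; do 5 ?[case: ifP => ?]; lia.
Qed.

(** Two consecutive blocks fix the position n+1 and permute the others in a
    single cycle of length 2n+1, which the right-hand side iterates. *)
Lemma track_blocks (n k x : nat) : (k <= n)%N -> (x <= n.*2.+1)%N ->
  track (flatten [seq coxeter_block n (odd j) | j <- iota 0 k.*2]) x =
  if (x <= n)%N then (if (k <= x)%N then x - k else n - x + k.+1)%N
  else if x == n.+1 then n.+1
  else if (x + k <= n.*2.+1)%N then (x + k)%N else (3 * n + 2 - x - k)%N.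
Proof.
move=> + hx; elim: k => [|k IHk] hk.
  by rewrite /=; do 5 ?[case: ifP => ?]; lia.
rewrite doubleS -addn2 iotaD map_cat flatten_cat track_cat IHk; last lia.
have -> : flatten [seq coxeter_block n (odd j) | j <- iota (0 + k.*2) 2] =
    iota 1 n.+1 ++ map (dual n) (iota 1 n.+1).
  by rewrite [iota _ 2]/= map_cons /= odd_double /= cats0.
rewrite track_cat.
set y := (if (x <= n)%N then _ else _).
have yE : [\/ [/\ (k <= x)%N, (x <= n)%N & y = x - k]%N,
    [/\ (x < k)%N & y = n - x + k.+1]%N,
    [/\ x = n.+1 & y = n.+1] |
    [/\ (n.+1 < x)%N, (x + k <= n.*2.+1)%N & y = x + k]%N \/
    [/\ (n.*2.+1 < x + k)%N & y = 3 * n + 2 - x - k]%N].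
  rewrite /y; case: ifP => h1; first case: ifP => h2.
  - by apply: Or41; split.
  - by apply: Or42; split=> //; lia.
  case: ifP => h2; first by apply: Or43; split=> //; lia.
  by case: ifP => h3; apply: Or44; [left|right]; split=> //; lia.
clearbody y; set z := track (iota 1 n.+1) y.
have zE : [\/ y = 0%N /\ z = n.+1, (0 < y <= n.+1)%N /\ z = y.-1
    | (n.+1 < y)%N /\ z = y].
  rewrite /z track_iota //; case: ifP => h1; first by apply: Or31; lia.
  by case: ifP => h2; [apply: Or32|apply: Or33]; lia.
clearbody z; have hz : (z <= n.*2.+1)%N.
  by case: yE => [[]|[]|[]|[[]|[]]]; case: zE => -[]; lia.
rewrite -{1}(subKn hz) track_dual ?is_word_iota; [|by []|by lia].
rewrite track_iota //.
by case: yE => [[]|[]|[]|[[]|[]]]; case: zE => -[];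
  do 8 ?[case: ifP => ?]; lia.
Qed.

Lemma central_bits_block (n : nat) (o : bool) : (1 <= n)%N ->
  central_bits n (coxeter_block n o) = [:: false; true].
Proof.
move=> n1; transitivity (central_bits n (iota 1 n.+1)).
  by case: o; rewrite /coxeter_block ?central_bits_dual ?is_word_iota.
have -> : iota 1 n.+1 = iota 1 n.-1 ++ [:: n; n.+1].
  by rewrite -[X in iota 1 X.+1](prednK n1) -addn2 iotaD /= add1n prednK.
rewrite central_bits_cat {1}/central_bits (_ : [seq x <- _ | _] = [::]).
  rewrite /central_bits /= !ifT /=; [|lia|lia].
  by rewrite eqxx; have -> : n == n.+1 = false by lia.
apply/eqP; rewrite -[_ == _]negbK -has_filter -all_predC.
by apply/allP => x; rewrite mem_iota /=; lia.
Qed.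

Lemma twisted_word_base (n : nat) : (1 <= n)%N -> twisted_word n (base_word n).
Proof.
move=> n1; rewrite base_wordE; split.
- rewrite /is_word; apply/allP => i /flattenP[s /mapP[k _ ->]].
  exact: (allP (is_word_block n (odd k))).
- move=> x hx; rewrite -addn1 iotaD map_cat flatten_cat track_cat.
  rewrite track_blocks // /= odd_double cats0 track_iota //.
  set y := (if (x <= n)%N then _ else _).
  have yE : [\/ x = n /\ y = 0%N, (x < n)%N /\ y = (n.*2.+1 - x)%N
      | (n < x)%N /\ y = (n.*2.+2 - x)%N].
    rewrite /y; case: ifP => h1.
      by case: ifP => h2; [apply: Or31|apply: Or32]; lia.
    by apply: Or33; do 2 ?[case: ifP => ?]; lia.
  by clearbody y; case: yE => -[]; do 2 ?[case: ifP => ?]; lia.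
- exists false; rewrite -[X in alternating X](size_iota 0 n.*2.+1).
  elim: (iota 0 _) => // k s IHs.
  by rewrite [size _]/= alternatingS -IHs /= central_bits_cat central_bits_block.
Qed.

Lemma twisted_adapted_word (n : nat) (w : word) :
  (1 <= n)%N -> twisted_adapted n w -> twisted_word n w.
Proof.
move=> n1; elim=> {w} [w /twisted_word_comm|i w v hi _ IH|i w v hi _ IH].
- by apply; exact: twisted_word_base.
- case=> [u wu uv|_ wv]; last exact: twisted_word_comm wv IH.
  by apply: twisted_word_comm uv _; apply: twisted_word_right; exact: twisted_word_comm wu IH.
- case=> [u wu uv|_ wv]; last exact: twisted_word_comm wv IH.
  by apply: twisted_word_comm uv _; apply: twisted_word_left; exact: twisted_word_comm wu IH.
Qed.

(** * Roots as crossings of strands *)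

Lemma evecE (m : nat) (a x : 'I_m.+1) : evec a ord0 x = Posz (x == a).
Proof. by rewrite /evec mxE /=; case: eqP. Qed.

Lemma reflectionB (m i : nat) (u v : 'rV[int]_m.+1) :
  reflection i (u - v) = reflection i u - reflection i v.
Proof. by apply/rowP => x; rewrite !mxE. Qed.

Lemma reflection_evec (m i x : nat) : (i <= m)%N -> (x <= m)%N ->
  reflection i (evec (inord x : 'I_m.+1)) = evec (inord (swap_pos i x)).
Proof.
move=> hi hx; apply/rowP => y; rewrite mxE !evecE; congr Posz; congr nat_of_bool.
rewrite -(inj_eq (@perm_inj _ (simple_perm m i))) /simple_perm tpermK.
congr (_ == _); rewrite /swap_pos.
have inordE (a b : nat) : (a <= m)%N -> (b <= m)%N ->
    ((inord a : 'I_m.+1) == inord b) = (a == b).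
  by move=> ha hb; rewrite -val_eqE /= !inordK.
case: tpermP => [/eqP|/eqP|/eqP h1 /eqP h2].
- by rewrite inordE //; [move/eqP ->; rewrite eqxx|lia].
- rewrite inordE //; move/eqP ->; rewrite eqxx.
  by case: eqP => // <-.
- rewrite ifF; last by move: h1; rewrite inordE //; [move/negbTE|lia].
  by rewrite ifF //; move: h2; rewrite inordE // => /negbTE.
Qed.

Lemma foldr_reflection (m x y : nat) (u : word) :
  is_word m u -> (x <= m)%N -> (y <= m)%N ->
  foldr (@reflection m) (evec (inord x) - evec (inord y)) u =
  evec (inord (foldr swap_pos x u)) - evec (inord (foldr swap_pos y u)) /\
  (foldr swap_pos x u <= m)%N /\ (foldr swap_pos y u <= m)%N.
Proof.
move=> + hx hy; elim: u => //= i u IHu /andP[hi /IHu[-> [h1 h2]]].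
rewrite reflectionB !reflection_evec //; [|lia|lia].
by rewrite !swap_pos_bound //; lia.
Qed.

Lemma foldrK (u : word) (x : nat) : track u (foldr swap_pos x u) = x.
Proof. by elim: u => //= i u IHu; rewrite swap_posK. Qed.

Lemma evecB_inj (m : nat) (a b c d : 'I_m.+1) :
  evec a - evec b = evec c - evec d -> c != d -> a = c /\ b = d.
Proof.
move=> e cd; have E x : (Posz (x == a) - Posz (x == b))%R = Posz (x == c) - Posz (x == d).
  by rewrite -!evecE; move/rowP/(_ x): e; rewrite !mxE.
split; apply/eqP; rewrite eq_sym.
  by have := E c; rewrite !eqxx (negbTE cd); case: eqP; case: eqP.
by have := E d; rewrite !eqxx (eq_sym d c) (negbTE cd); case: eqP; case: eqP.
Qed.

Lemma root_at_track (m t : nat) (w : word) (b : posroot m) :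
  is_word m w -> (t < size w)%N ->
  root_at m w t = rootvec b <->
  track (take t w) (val b).1 = (nth 0%N w t).-1 /\
  track (take t w) (val b).2 = nth 0%N w t.
Proof.
move=> hw ht; set i := nth _ _ _.
have hi : (0 < i <= m)%N by apply: (allP hw); exact: mem_nth.
have hu : is_word m (take t w) by apply/allP => x /mem_take; exact: (allP hw).
rewrite /root_at /simple_root -/i.
have [|||-> [hx hy]] := foldr_reflection m i.-1 i (take t w) => //; try lia.
have b12 : (val b).1 != (val b).2 by rewrite -val_eqE neq_ltn (valP b).
split.
  case/evecB_inj => // <- <-; rewrite !inordK //; by rewrite !foldrK.
move=> [h1 h2]; rewrite /rootvec.
have -> : (val b).1 = inord (foldr swap_pos i.-1 (take t w)).
  by apply: val_inj; rewrite /= inordK //; apply: (track_inj (take t w)); rewrite foldrK.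
have -> : (val b).2 = inord (foldr swap_pos i (take t w)).
  by apply: val_inj; rewrite /= inordK //; apply: (track_inj (take t w)); rewrite foldrK.
by [].
Qed.

(** Take the first letter at which the order of the two strands changes. *)
Lemma strands_cross (w : word) (a b : nat) :
  (a < b)%N -> (track w b < track w a)%N ->
  exists t, [/\ (t < size w)%N, track (take t w) a = (nth 0%N w t).-1
    & track (take t w) b = nth 0%N w t].
Proof.
elim: w a b => [|i w IHw] a b /= ab; first by lia.
have [h _|h h'] := ltnP (swap_pos i b) (swap_pos i a).
  exists 0%N; rewrite take0 /=; move: h; rewrite /swap_pos.
  by do 4 ?[case: ifP => ?]; split=> //; lia.
have [|t [h1 h2 h3]] := IHw (swap_pos i a) (swap_pos i b) _ h'.
  rewrite ltn_neqAle h andbT (inj_eq (inv_inj (swap_posK i))); lia.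
by exists t.+1.
Qed.

(** Every positive root occurs in the word, since all pairs of strands get
    reversed. *)
Lemma pos_track (n : nat) (w : word) (b : posroot n.*2.+1) : twisted_word n w ->
  [/\ (pos w b < size w)%N, (0 < residue w b <= n.*2.+1)%N,
      track (take (pos w b) w) (val b).1 = (residue w b).-1
    & track (take (pos w b) w) (val b).2 = residue w b].
Proof.
move=> [hw tw _]; have bT := valP b.
have [|t [ht h1 h2]] := strands_cross w (val b).1 (val b).2 bT.
  have h1 := ltn_ord (val b).1; have h2 := ltn_ord (val b).2.
  by rewrite !tw -1?ltnS //; apply: ltn_sub2l => //; apply: leq_trans bT _.
have hp : (pos w b < size w)%N.
  rewrite /pos -[X in (_ < X)%N](size_mkseq (root_at n.*2.+1 w)) index_mem.
  have <- : root_at n.*2.+1 w t = rootvec b by apply/root_at_track.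
  by rewrite -(nth_mkseq 0 _ ht) mem_nth // size_mkseq.
have : root_at n.*2.+1 w (pos w b) = rootvec b.
  rewrite -(nth_mkseq 0 (root_at n.*2.+1 w) hp) nth_index //.
  by rewrite -index_mem size_mkseq.
case/root_at_track => // h3 h4; split=> //.
by apply: (allP hw); exact: mem_nth.
Qed.

(** * Coordinates as heights *)

Lemma count_between (w : word) (x s t : nat) : (s < t <= size w)%N ->
  (forall k, (s < k < t)%N -> nth 0%N w k <> x) ->
  count_mem x (take t w) = (count_mem x (take s w) + (nth 0%N w s == x))%N.
Proof.
elim: t => // t IHt hst H.
rewrite (take_nth 0%N); last lia.
rewrite -cats1 count_cat /=.
have [e|st] := eqVneq t s; first by rewrite e addn0.
rewrite IHt; [|lia|by move=> k hk; apply: H; lia].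
have /eqP/negbTE -> : nth 0%N w t <> x by apply: H; lia.
by rewrite !addn0.
Qed.

Lemma peak_mid (n : nat) (g : nat -> int) (c i : nat) : (1 <= n)%N ->
  is_peak n g i -> balanced n g c -> i = n \/ i = n.+2 -> g i = g n.+1 + 1.
Proof.
by move=> n1 pk [_ hc] [] e; subst i; have := pk n.+1; case: hc => -[]; lia.
Qed.

(** For a central root the arrow leads to a crossing at level n or n+2 with no
    letter n+1 strictly in between; there the height of that level is the
    central height plus one half ([peak_mid]), which is the shift for an outgoing
    arrow.  For an incoming arrow the central height has dropped by one at [b]
    in the meantime, whence the opposite sign. *)
Lemma Omega_height (n : nat) (w : word) (xi : nat -> int) (g : nat -> int)
    (c : nat) (b : posroot n.*2.+1) (x : nat * rat) :
  (1 <= n)%N -> twisted_word n w -> peak_word n g w -> balanced n g c ->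
  (forall i, (0 < i <= n)%N -> g i = 2 * xi i) ->
  (forall i, (n < i <= n.*2)%N -> g i.+1 = 2 * xi i) ->
  Omega w xi b x ->
  x.1 = residue w b /\ 2 * x.2 = (heights_after n g (take (pos w b) w) x.1)%:~R.
Proof.
move=> n1 rw fw bal g1 g2.
have mid (d : posroot n.*2.+1) : residue w d = n \/ residue w d = n.+2 ->
    heights_after n g (take (pos w d) w) (residue w d) =
    heights_after n g (take (pos w d) w) n.+1 + 1.
  have [hp _ _ _] := pos_track n w d rw.
  have [hw _ _] := rw.
  have [pk bal' _] := peak_word_after n g w c (pos w d) n1 hw fw bal hp.
  exact: peak_mid n1 pk bal'.
elim=> {b x} [b h|b h|b d j p h [hs ha h1 h2] _ [/= ej ep]|b d j p h [hs ha h1 h2] _ [/= ej ep]].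
- have [_ hr _ _] := pos_track n w b rw.
  rewrite /= heights_afterE g1; last lia.
  have -> : drop_size n (residue w b) = 4 by rewrite /drop_size ifF; lia.
  by split=> //; rewrite /rank_in_residue rmorphB !rmorphM /=; ring.
- have [_ hr _ _] := pos_track n w b rw.
  have e : residue w b = (residue w b).-1.+1 by lia.
  have gE : g (residue w b) = 2 * xi (residue w b).-1 by rewrite {1}e g2 //; lia.
  rewrite /= heights_afterE gE.
  have -> : drop_size n (residue w b) = 4 by rewrite /drop_size ifF; lia.
  by split=> //; rewrite /rank_in_residue rmorphB !rmorphM /=; ring.
- split=> //=; rewrite -/(residue w d) -/(residue w b) in ha h1 h2.
  have hm : residue w d = n \/ residue w d = n.+2 by lia.
  have := mid d hm; move: ep; rewrite ej mulrDr => ->.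
  rewrite !heights_afterE (count_between w _ (pos w b) (pos w d)); [|lia|exact: h2].
  rewrite (count_between w n.+1 (pos w b) (pos w d)); [|lia|by rewrite -h].
  rewrite -!/(residue w b) h eqxx.
  have -> : n.+1 == residue w d = false by lia.
  rewrite addn0 => ->; rewrite /drop_size eqxx.
  have -> : 2 * (1 / 2) = 1%:~R :> rat by [].
  by rewrite -rmorphD /=; congr (_%:~R); lia.
- split=> //=; rewrite -/(residue w d) -/(residue w b) in ha h1 h2.
  have hm : residue w d = n \/ residue w d = n.+2 by lia.
  have := mid d hm; move: ep; rewrite ej mulrBr => -> ->.
  rewrite !heights_afterE (count_between w n.+1 (pos w d) (pos w b)); [|lia|by rewrite -h].
  rewrite -!/(residue w d).
  have -> : residue w d == n.+1 = false by lia.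
  have -> : 2 * (1 / 2) = 1%:~R :> rat by [].
  by rewrite addn0 -rmorphB /=; congr (_%:~R); lia.
Qed.

(** * The crossing of two strands *)

(** Here [A] and [B] are the heights at which two strands of the same direction
    meet the bouncing strand, and [G] the height at which they cross each other,
    at the doubled level [2m].  Subtracting the congruences gives 4m = A - B
    modulo 8n+4, hence [m]; adding the window for [G], which is narrower than
    the modulus on either side of the solution, gives [G]. *)
Lemma crossing_arith (n m : nat) (A B G u v : int) :
  (1 <= m <= n.*2)%N -> `|A - B| <= 4 * n%:Z ->
  `|G - A| <= (if (m <= n)%N then 6 * n%:Z + 5 - 2 * m%:Z else 2 * n%:Z + 3 + 2 * m%:Z) ->
  G + 2 * m%:Z = A + (2 * n%:Z + 1) + (8 * n%:Z + 4) * u ->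
  G - 2 * m%:Z = B + (2 * n%:Z + 1) + (8 * n%:Z + 4) * v ->
  exists l : nat, [/\ (1 <= l <= n)%N, m = l \/ m = (n.*2.+1 - l)%N
    & (B = A + 4 * l%:Z /\ G = A - (2 * n%:Z + 1) + 2 * l%:Z) \/
      (B = A - 4 * l%:Z /\ G = A + (2 * n%:Z + 1) - 2 * l%:Z)].
Proof.
move=> hm hAB hG e1 e2.
have e3 : 4 * m%:Z = A - B + (8 * n%:Z + 4) * (u - v).
  by rewrite mulrBr; lia.
have uv : u - v = 0 \/ u - v = 1.
  have : -1 < u - v < 2 by nia.
  by lia.
have [hmn|hmn] : (u - v = 0 /\ (m <= n)%N) \/ (u - v = 1 /\ (n < m)%N).
  by case: uv => h; rewrite h in e3; lia.
- have [uv0 mn] := hmn; rewrite uv0 in e3; rewrite mn in hG.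
  have hu : u = 0.
    have : -1 < u < 1 by nia.
    by lia.
  by rewrite hu in e1; exists m; split; [lia|left|right; lia].
- have [uv1 mn] := hmn; rewrite uv1 in e3.
  rewrite leqNgt mn /= in hG.
  have hu : u = 0.
    have : -1 < u < 1 by nia.
    by lia.
  by rewrite hu in e1; exists (n.*2.+1 - m)%N; split; [lia|right; lia|left; lia].
Qed.

Lemma balanced_near (n : nat) (g : nat -> int) (c i : nat) : (1 <= n)%N ->
  balanced n g c -> (0 < i <= n.*2.+1)%N -> i != n.+1 ->
  `|g i - g n.+1| <=
  (if (i <= n)%N then 2 * n%:Z + 3 - 2 * i%:Z else 2 * i%:Z - 2 * n%:Z - 1).
Proof.
move=> n1 [hg hc] hi ni.
have h0 : `|g n - g n.+1| <= 3 /\ `|g n.+2 - g n.+1| <= 3.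
  by case: hc => -[]; lia.
case: ifP => h.
  have [k ek] : exists k, (i + k = n)%N by exists (n - i)%N; lia.
  elim: k i hi ni h ek => [|k IHk] i hi ni h ek.
    by rewrite (_ : i = n); lia.
  have := IHk i.+1; have := hg i; lia.
have [k ek] : exists k, (i = n.+2 + k)%N by exists (i - n.+2)%N; lia.
elim: k i hi ni h ek => [|k IHk] i hi ni h ek.
  by rewrite (_ : i = n.+2); lia.
by have := IHk i.-1; have := hg i.-1; rewrite (prednK (_ : 0 < i)%N); lia.
Qed.

(** A balanced height function with a peak at n or n+2 has the bouncing strand on
    the other side of n+1, so this strand crosses only at level n+1. *)
Lemma strand_residue (n : nat) (w : word) (g : nat -> int) (c : nat)
    (b : posroot n.*2.+1) :
  (1 <= n)%N -> twisted_word n w -> peak_word n g w -> balanced n g c ->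
  let h := heights_after n g (take (pos w b) w) in
  [/\ is_peak n h (residue w b),
      exists c', balanced n h c',
      residue w b = n.+1 <-> (val b).1 = c :> nat \/ (val b).2 = c :> nat
    & ((val b).1 != c :> nat ->
         same_phase n (h (residue w b) + level n (residue w b)) (phase n g (val b).1)) /\
      ((val b).2 != c :> nat ->
         same_phase n (h (residue w b) - level n (residue w b)) (phase n g (val b).2))].
Proof.
move=> n1 rw fw bal h.
have [hp hr t1 t2] := pos_track n w b rw.
have [hw _ _] := rw.
have [pk bal' ph] := peak_word_after n g w c (pos w b) n1 hw fw bal hp.
rewrite -/h -/(residue w b) in pk bal' ph.
split=> //.
- by exists (track (take (pos w b) w) c).
- split=> [er|].
    have := bal'.2; have tc := track_inj (take (pos w b) w).
    case=> -[ec _ _]; [left|right]; apply: tc; rewrite ec.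
      by rewrite t1 er.
    by rewrite t2 er.
  case=> e; case: bal'.2; rewrite -e ?t1 ?t2 => -[ec e1 e2].
  + by lia.
  + have er : residue w b = n.+2 by lia.
    by have := pk n.+1; rewrite er; lia.
  + have er : residue w b = n by lia.
    by have := pk n.+1; rewrite er; lia.
  + by [].
- split=> hc; have := ph _ hc; rewrite ?t1 ?t2.
    by rewrite phase_rising.
  by rewrite phase_falling.
Qed.

(** The two roots bounding the interval on which the sequences differ carry a
    larger value in the pair, hence are its members; and the sequences differ at
    [c]. *)
Lemma class_lt_between (m : nat) (w : word) (a b c : posroot m) :
  (pos w a < pos w b)%N -> class_lt w (root_ind c) (pair_ind a b) ->
  a != c -> b != c ->
  (pos w a <= pos w c <= pos w b)%N.
Proof.
move=> ab /(_ w (rt_refl _ _ _)) [x [y [xy out hx hy]]] ac bc.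
have inab z : (root_ind c z < pair_ind a b z)%N -> z = a \/ z = b.
  rewrite !ffunE; have [->|_] := eqVneq z a; first by left.
  by have [->|_ /=] := eqVneq z b; [right | case: eqP].
have hc : root_ind c c <> pair_ind a b c.
  by rewrite !ffunE eqxx (eq_sym c a) (eq_sym c b) (negbTE ac) (negbTE bc).
have : ~~ ((pos w c < pos w x)%N || (pos w y < pos w c)%N).
  by apply/negP => /out /hc.
have [] := inab x hx; have [] := inab y hy; move=> ? ?; subst x y; lia.
Qed.

Lemma posroot_neq (m : nat) (b : posroot m) : (val b).1 != (val b).2.
Proof. by rewrite -val_eqE neq_ltn (valP b). Qed.

(** The positive part e_x of the sum comes from one of the summands; after
    cancelling it, the other summand is read off. *)
Lemma root_sum (m : nat) (a b c : posroot m) :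
  rootvec a + rootvec b = rootvec c ->
  [/\ (val a).1 = (val c).1, (val a).2 = (val b).1 & (val b).2 = (val c).2] \/
  [/\ (val b).1 = (val c).1, (val b).2 = (val a).1 & (val a).2 = (val c).2].
Proof.
have split_at (x y : posroot m) : rootvec x + rootvec y = rootvec c ->
    (val x).1 = (val c).1 ->
    [/\ (val x).1 = (val c).1, (val x).2 = (val y).1 & (val y).2 = (val c).2].
  move=> e e1; have [||//] := @evecB_inj m (val x).2 (val c).2 (val y).1 (val y).2.
  - apply: (addrI (rootvec x)); rewrite -/(rootvec y) e /rootvec e1.
    by rewrite addrA subrK.
  - exact: posroot_neq.
move=> e; have : (val a).1 = (val c).1 \/ (val b).1 = (val c).1.
  move/rowP/(_ (val c).1): (e); rewrite /rootvec !mxE -!/(evec _ _ _) !eqxx /=.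
  rewrite (negbTE (posroot_neq m c)) !(eq_sym (val c).1).
  have [?|_] := eqVneq (val a).1 (val c).1; first by left.
  have [?|_] := eqVneq (val b).1 (val c).1; first by right.
  by case: eqP; case: eqP.
case=> e1; first by left; exact: split_at.
by right; apply: split_at => //; rewrite addrC.
Qed.

Definition height_at (n : nat) (g : nat -> int) (w : word)
    (b : posroot n.*2.+1) : int :=
  heights_after n g (take (pos w b) w) (residue w b).

Lemma central_count (n : nat) (w : word) : twisted_word n w ->
  count_mem n.+1 w = n.*2.+1.
Proof. by case=> _ _ [b eb]; rewrite -count_central_bits eb count_alternating. Qed.

(** The bound is 2n rather than 2n+1 because the letter at [b] itself is n+1. *)
Lemma central_height (n : nat) (g : nat -> int) (w : word) (b : posroot n.*2.+1) :
  twisted_word n w -> residue w b = n.+1 ->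
  height_at n g w b = g n.+1 - 2 * (count_mem n.+1 (take (pos w b) w))%:Z /\
  (count_mem n.+1 (take (pos w b) w) <= n.*2)%N.
Proof.
move=> rw er; have [hp _ _ _] := pos_track n w b rw; split.
  by rewrite /height_at er heights_afterE /drop_size eqxx.
have := central_count n w rw.
rewrite -{1}(cat_take_drop (pos w b).+1 w) count_cat (take_nth 0%N) //.
by rewrite -cats1 count_cat /= -/(residue w b) er eqxx; lia.
Qed.

Lemma central_decreasing (n : nat) (g : nat -> int) (w : word)
    (a b : posroot n.*2.+1) :
  twisted_word n w -> residue w a = n.+1 -> residue w b = n.+1 ->
  (pos w a <= pos w b)%N -> height_at n g w b <= height_at n g w a.
Proof.
move=> rw ea eb ab; rewrite /height_at ea eb !heights_afterE /drop_size eqxx.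
rewrite -{1}(subnKC ab) takeD count_cat; lia.
Qed.

(** The two configurations differ by the direction in which the strands pass the
    bouncing one; negating all heights carries the second into the first. *)
Lemma pair_heights (n : nat) (w : word) (g : nat -> int) (c : nat)
    (gamma x y : posroot n.*2.+1) :
  (1 <= n)%N -> twisted_word n w -> peak_word n g w -> balanced n g c ->
  [/\ (val gamma).2 = c :> nat, (val x).2 = c :> nat,
      (val y).1 = (val gamma).1 & (val y).2 = (val x).1] \/
  [/\ (val gamma).1 = c :> nat, (val x).1 = c :> nat,
      (val y).2 = (val gamma).2 & (val y).1 = (val x).2] ->
  let A := height_at n g w gamma in
  let B := height_at n g w x in
  let G := height_at n g w y in
  residue w x = n.+1 /\
  exists l : nat, [/\ (1 <= l <= n)%N,
      residue w y = l \/ residue w y = (n.*2.+2 - l)%N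
    & (B = A + 4 * l%:Z /\ G = A - (2 * n%:Z + 1) + 2 * l%:Z) \/
      (B = A - 4 * l%:Z /\ G = A + (2 * n%:Z + 1) - 2 * l%:Z)].
Proof.
move=> n1 rw fw bal conf A B G.
have bneq (d : posroot n.*2.+1) : (val d).1 != (val d).2 :> nat.
  by rewrite val_eqE posroot_neq.
have [_ _ cg phg] := strand_residue n w g c gamma n1 rw fw bal.
have [_ _ cx phx] := strand_residue n w g c x n1 rw fw bal.
have [_ [c' bal'] cy phy] := strand_residue n w g c y n1 rw fw bal.
have eg : residue w gamma = n.+1 by apply/cg; case: conf => -[h _ _ _]; [right|left].
have ex : residue w x = n.+1 by apply/cx; case: conf => -[_ h _ _]; [right|left].
have ngx := bneq gamma; have nx := bneq x.
have ey : residue w y != n.+1.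
  apply/eqP => /cy h; case: conf => -[h1 h2 h3 h4];
  by move: h ngx nx; rewrite h3 h4 h1 h2 => -[->|->]; rewrite eqxx.
have [_ hr _ _] := pos_track n w y rw.
pose m := if (residue w y <= n)%N then residue w y else (residue w y).-1.
have lm : level n (residue w y) = 2 * m%:Z.
  by rewrite /level /m (negbTE ey); clear - hr; case: ifP; lia.
have hm : (1 <= m <= n.*2)%N by rewrite /m; clear - hr ey; case: ifP; lia.
have mn : (m <= n)%N = (residue w y <= n)%N by rewrite /m; clear - hr ey; case: ifP; lia.
have [eA kA] := central_height n g w gamma rw eg.
have [eB kB] := central_height n g w x rw ex.
rewrite -/A in eA; rewrite -/B in eB.
have near := balanced_near n _ _ _ n1 bal' hr ey.
rewrite -/(height_at n g w y) -/G heights_afterE /drop_size eqxx in near.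
have kG : (count_mem n.+1 (take (pos w y) w) <= n.*2.+1)%N.
  apply: leq_trans (leq_addr (count_mem n.+1 (drop (pos w y) w)) _) _.
  by rewrite -count_cat cat_take_drop (central_count n w rw).
have lev : level n n.+1 = 2 * n%:Z + 1 by rewrite /level ltnn eqxx; clear; lia.
rewrite -/(height_at n g w gamma) eg lev -/A in phg.
rewrite -/(height_at n g w x) ex lev -/B in phx.
rewrite -/(height_at n g w y) lm -/G in phy.
clearbody A B G.
have hAB : `|A - B| <= 4 * n%:Z by clear - kA kB eA eB; lia.
have hG : `|G - A| <=
    (if (m <= n)%N then 6 * n%:Z + 5 - 2 * m%:Z else 2 * n%:Z + 3 + 2 * m%:Z).
  move: near; rewrite mn /m eA; clear - kA kG hr ey.
  by case: ifP; lia.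
have res l : m = l \/ m = (n.*2.+1 - l)%N -> (1 <= l <= n)%N ->
    residue w y = l \/ residue w y = (n.*2.+2 - l)%N.
  by rewrite /m; clear - hr ey; case: ifP; lia.
split=> //.
case: conf => -[h1 h2 h3 h4].
- have [|u1 e1] := phg.1; first by rewrite -h1.
  have [|v1 e2] := phx.1; first by rewrite -h2.
  have [|u2 e3] := phy.1; first by rewrite h3 -h1.
  have [|v2 e4] := phy.2; first by rewrite h4 -h2.
  rewrite h3 in e3; rewrite h4 in e4.
  have [||l [hl ml hBG]] :=
    crossing_arith n m A B G (u2 - u1) (v2 - v1) hm hAB hG.
  + by rewrite e3 e1; ring.
  + by rewrite e4 e2; ring.
  by exists l; split=> //; exact: res.
- have [|u1 e1] := phg.2; first by rewrite -h1 eq_sym.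
  have [|v1 e2] := phx.2; first by rewrite -h2 eq_sym.
  have [|u2 e3] := phy.2; first by rewrite h3 -h1 eq_sym.
  have [|v2 e4] := phy.1; first by rewrite h4 -h2 eq_sym.
  rewrite h3 in e3; rewrite h4 in e4.
  have hAB' : `|- A - - B| <= 4 * n%:Z by clear - hAB; lia.
  have hG' : `|- G - - A| <=
      (if (m <= n)%N then 6 * n%:Z + 5 - 2 * m%:Z else 2 * n%:Z + 3 + 2 * m%:Z).
    by clear - hG; move: hG; case: ifP; lia.
  have [||l [hl ml hBG]] :=
    crossing_arith n m (- A) (- B) (- G) (u1 - u2) (v1 - v2) hm hAB' hG'.
  + have -> : - G + 2 * m%:Z = - (G - 2 * m%:Z) by ring.
    have -> : - A = - (A - (2 * n%:Z + 1)) - (2 * n%:Z + 1) by ring.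
    by rewrite e3 e1; ring.
  + have -> : - G - 2 * m%:Z = - (G + 2 * m%:Z) by ring.
    have -> : - B = - (B - (2 * n%:Z + 1)) - (2 * n%:Z + 1) by ring.
    by rewrite e4 e2; ring.
  by exists l; split=> //; [exact: res | clear - hBG; lia].
Qed.

Theorem lemma6p27 (n : nat) (i0 : word) (Q : rel nat) (xi : nat -> int)
    (gamma alpha beta : posroot n.*2.+1) (r : rat)
    (i : nat) (p : rat) (j : nat) (q : rat) :
  (1 <= n)%N ->
  twisted_adapted n i0 ->
  quiver_of n i0 Q ->
  height_function Q xi ->
  ~ is_simple gamma ->
  non_induced i0 gamma ->
  Omega i0 xi gamma (n.+1, r) ->
  minimal_pair i0 alpha beta gamma ->
  Omega i0 xi alpha (i, p) ->
  Omega i0 xi beta (j, q) ->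
  exists l : nat, (1 <= l)%N /\
    [\/ (i, p) = (n.+1, r + 2 * l%:R) /\
        (j, q) = (l, r - 1 / 2 - (n%:R - l%:R)),
        (i, p) = (n.+1, r + 2 * l%:R) /\
        (j, q) = ((n.*2.+2 - l)%N, r - 1 / 2 - (n%:R - l%:R)),
        (i, p) = (l, r + 1 / 2 + (n%:R - l%:R)) /\
        (j, q) = (n.+1, r - 2 * l%:R)
      | (i, p) = ((n.*2.+2 - l)%N, r + 1 / 2 + (n%:R - l%:R)) /\
        (j, q) = (n.+1, r - 2 * l%:R)].
Proof.
move=> n1 ta [dQ _ aQ] hxi _ eg og [[_ pab] sum lt _] oa ob.
have rw := twisted_adapted_word n i0 n1 ta.
have [hw _ [b eb]] := rw.
have [g [c [g1 g2 g3 bal]]] := balanced_start n Q xi b n1 dQ hxi.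
have fw : peak_word n g i0.
  apply: (peak_word_adapted n i0 Q xi b g) => //.
  by rewrite eb alternates_alternating.
have height d x := Omega_height n i0 xi g c d x n1 rw fw bal g1 g2.
have [_ hr] := height _ _ og; have [/= ea hp] := height _ _ oa.
have [/= eb' hq] := height _ _ ob; rewrite /= -eg -/(height_at n g i0 gamma) in hr.
rewrite ea -/(height_at n g i0 alpha) in hp.
rewrite eb' -/(height_at n g i0 beta) in hq.
have neq (x y : posroot n.*2.+1) : rootvec x + rootvec y = rootvec gamma ->
    x != gamma.
  move=> e; apply/eqP => ex.
  have : rootvec y = 0 by apply: (addrI (rootvec x)); rewrite addr0 e ex.
  move/rowP/(_ (val y).1); rewrite /rootvec !mxE /= eqxx.
  by rewrite (negbTE (posroot_neq _ y)).
have ac := neq _ _ sum; have bc : beta != gamma by apply: (neq _ alpha); rewrite addrC.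
have [/andP[pac pcb]] := class_lt_between _ _ _ _ _ pab lt ac bc.
have [_ _ cg _] := strand_residue n i0 g c gamma n1 rw fw bal.
pose conf (x y : posroot n.*2.+1) :=
  [/\ (val gamma).2 = c :> nat, (val x).2 = c :> nat,
      (val y).1 = (val gamma).1 & (val y).2 = (val x).1] \/
  [/\ (val gamma).1 = c :> nat, (val x).1 = c :> nat,
      (val y).2 = (val gamma).2 & (val y).1 = (val x).2].
have [hc|hc] : conf alpha beta \/ conf beta alpha.
  case/root_sum: sum => -[s1 s2 s3]; case: (cg.1 eg) => e.
  - by left; right; split=> //; rewrite s1.
  - by right; left; split=> //; rewrite s3.
  - by right; right; split=> //; rewrite s1.
  - by left; left; split=> //; rewrite s3.
(* Here alpha is the crossing with the bouncing strand and beta is induced. *)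
- have [ex [l [hl hres hBG]]] := pair_heights n i0 g c _ _ _ n1 rw fw bal hc.
  have := central_decreasing n g i0 _ _ rw ex eg pac.
  move: hBG hr hp hq; rewrite -ea in ex; rewrite -eb' in hres.
  move: (height_at _ _ _ gamma) (height_at _ _ _ alpha) (height_at _ _ _ beta).
  move=> A B G hBG hr hp hq le; have [eB eG] :
      B = A + 4 * l%:Z /\ G = A - (2 * n%:Z + 1) + 2 * l%:Z by lia.
  have ep : p = r + 2 * l%:R.
    by move: hp; rewrite eB rmorphD rmorphM /= -hr; lra.
  have eq : q = r - 1 / 2 - (n%:R - l%:R).
    move: hq; rewrite eG !(rmorphD, rmorphN, rmorphM) /= -hr; lra.
  exists l; split; first by lia.
  by rewrite ep eq ex; case: hres => ->; [apply: Or41|apply: Or42].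
(* Here beta is the crossing with the bouncing strand and alpha is induced. *)
- have [ex [l [hl hres hBG]]] := pair_heights n i0 g c _ _ _ n1 rw fw bal hc.
  have := central_decreasing n g i0 _ _ rw eg ex pcb.
  move: hBG hr hp hq; rewrite -eb' in ex; rewrite -ea in hres.
  move: (height_at _ _ _ gamma) (height_at _ _ _ alpha) (height_at _ _ _ beta).
  move=> A B G hBG hr hp hq le; have [eB eG] :
      G = A - 4 * l%:Z /\ B = A + (2 * n%:Z + 1) - 2 * l%:Z by lia.
  have ep : p = r + 1 / 2 + (n%:R - l%:R).
    by move: hp; rewrite eG !(rmorphD, rmorphN, rmorphM) /= -hr; lra.
  have eq : q = r - 2 * l%:R.
    by move: hq; rewrite eB !(rmorphD, rmorphN, rmorphM) /= -hr; lra.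
  exists l; split; first by lia.
  by rewrite ep eq ex; case: hres => ->; [apply: Or43|apply: Or44].
Qed.
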